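(* For all integers $n\ge2$ the Hankel determinant $\mathcal{H}(n,1)$ is nonzero and $$\operatorname{sgn}\mathcal{H}(n,1)=\sigma(n).$$
   Context: For $n\ge1$, $\mathcal{H}(n,1)=\det[s(i+j)]_{0\le i,j<n}$, where $s(m)$ is the sum of the binary digits of $m\ge0$. The sequence $\sigma(n)\in\{1,-1\}$, $n\ge2$, is defined by $\sigma(2)=-1$, $\sigma(4)=1$ and, for $n\ge3$, $n\ne4$, with $k\ge 0$ the integer such that $2^k<n\le2^{k+1}$, $$\sigma(n)=\begin{cases}(-1)^n\sigma(2^{k+1}-n+1)&\text{if }2^k<n\le3\cdot2^{k-1},\\ \sigma(n-2^k)&\text{if }3\cdot2^{k-1}<n\le2^{k+1}.\end{cases}$$ *)

(* Defs.v *)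
From mathcomp Require Import all_boot all_order all_algebra.
From mathcomp Require Import zify.

Set Implicit Arguments.
Unset Strict Implicit.
Unset Printing Implicit Defensive.

Import Order.TTheory GRing.Theory Num.Theory.
Local Open Scope ring_scope.

(* The i-th binary digit of m is [odd (m %/ 2 ^ i)]; the digits of index
   i >= m all vanish, since m < 2 ^ m. *)
Definition digit_sum (m : nat) : nat := (\sum_(i < m) odd (m %/ 2 ^ i))%N.

Definition hankel (n : nat) : int :=
  \det (\matrix_(i < n, j < n) (digit_sum (i + j))%:Z).

(* For n >= 2, [trunc_log 2 n.-1] is the k with 2 ^ k < n <= 2 ^ k.+1.
   The recursion is on a fuel argument; [sigmaE] shows that [sigma] satisfies
   the intended recurrence. Values at n < 2 are irrelevant. *)
Fixpoint sigma_rec (fuel n : nat) : int :=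
  if fuel is f.+1 then
    if n == 2%N then -1
    else if n == 4%N then 1
    else let k := trunc_log 2 n.-1 in
      if (n <= 3 * 2 ^ k.-1)%N then (-1) ^+ n * sigma_rec f (2 ^ k.+1 - n + 1)
      else sigma_rec f (n - 2 ^ k)
  else 1.

Definition sigma (n : nat) : int := sigma_rec n n.

Lemma sigma2 : sigma 2 = -1. Proof. by []. Qed.

Lemma sigma4 : sigma 4 = 1. Proof. by []. Qed.

Lemma sigma_step_bounds (n k : nat) :
    (3 <= n)%N -> n != 4%N -> (2 ^ k < n <= 2 ^ k.+1)%N ->
  if (n <= 3 * 2 ^ k.-1)%N then (2 <= 2 ^ k.+1 - n + 1 < n)%N
  else (2 <= n - 2 ^ k < n)%N.
Proof.
case: k => [|[|k]]; [by rewrite expn0 expn1; lia| |].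
  by rewrite /= !expnS expn0; case: ifP; lia.
have : (0 < 2 ^ k)%N by rewrite expn_gt0.
rewrite /= !expnS; move: (2 ^ k)%N => e; case: ifP; lia.
Qed.

Lemma sigma_rec_fuel (f g n : nat) :
  (2 <= n)%N -> (n <= f)%N -> (n <= g)%N -> sigma_rec f n = sigma_rec g n.
Proof.
elim: f g n => [|f IH] [|g] n n2 nf ng; try lia.
rewrite /=; case: eqP => [//|/eqP n2'].
case: eqP => [//|/eqP n4].
have n3 : (3 <= n)%N by lia.
have hk : (2 ^ trunc_log 2 n.-1 < n <= 2 ^ (trunc_log 2 n.-1).+1)%N.
  have n0 : (0 < n.-1)%N by lia.
  by have := trunc_log_bounds (isT : 1 < 2)%N n0; lia.
have := sigma_step_bounds n3 n4 hk.
by case: ifP => _ ?; rewrite (IH g) //; lia.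
Qed.

Lemma sigmaE (n k : nat) :
    (3 <= n)%N -> n != 4%N -> (2 ^ k < n <= 2 ^ k.+1)%N ->
  sigma n = if (n <= 3 * 2 ^ k.-1)%N then (-1) ^+ n * sigma (2 ^ k.+1 - n + 1)
            else sigma (n - 2 ^ k).
Proof.
move=> n3 n4 hk; have := sigma_step_bounds n3 n4 hk.
case: n n3 n4 hk => [|n] // n3 n4 hk.
have kE : trunc_log 2 n = k by apply: trunc_log_eq; lia.
rewrite {1}/sigma /= (negbTE n4) kE.
have -> : (n.+1 == 2)%N = false by lia.
by case: ifP => _ ?; [congr (_ * _) |]; apply: sigma_rec_fuel; lia.
Qed.

(* Main.v *)
Require Import Defs.
From mathcomp Require Import all_boot all_order all_algebra.
From mathcomp Require Import fingroup perm zify ring lra.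

Set Implicit Arguments.
Unset Strict Implicit.
Unset Printing Implicit Defensive.

Import Order.TTheory GRing.Theory Num.Theory.
Local Open Scope ring_scope.

(** Let [s] be the digit sum, [d] its difference sequence, [g] that of [d]
(below [digits], [diff1], [diff2]), and for a sequence [u] let
[u_n(x) = det (u (i + j) + x)], [i, j < n]; put [p = ceil (n / 2)] and
[q = floor (n / 2)].  Binary digits give [s (2m) = s m], [s (2m+1) = s m + 1],
hence [d (2m) = 1], [d (2m+1) = d m - 1], [g (2m) = d m - 2 = - g (2m+1)].
Sorting rows and columns by parity therefore expresses each of these
determinants through half-size ones, after an elimination step that leaves
blocks that are constant or Hankel:

- [g_n(0) = d_p(-2) g_q(0)] ([pencil_diff2]);
- [d_(2m)(x) = (-1)^m d_m(2x) d_m(-2)] ([pencil_diff1_even]);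
- [d_(2m+1)(x) = (-1)^m g_m(0)^2 (1 + x)] ([pencil_diff1_odd]);
- [s_n(x) = d_q(-2) s_p(x - c')], where [d_q(0) = d_q(-2) (1 + 2c')]
  ([pencil_digits_step]).

The first three show by induction that [d_n(x) = c (1 + t x)] for some [t >= 1]
and some [c <> 0] whose sign is known ([pencil_diff1_affine]).  In particular
[d_q(-2) = c (1 - 2t)] is nonzero, of sign [(-1)^(ceil (q / 2))], and
[1 + 2c' = 1 / (1 - 2t)] is negative, so [- c' > 0].  Since [s_1(x) = x], the last
relation makes [s_n(x)] equal to [b (x + r)] with [r > 0] for [n >= 2]: the root
of the pencil only moves to the left of [0].  Hence [s_n(0) = b r] is nonzero and
has the sign of [b], which is multiplied by [(-1)^(ceil (q / 2))] in the step
from [p] to [n].  The sequence [sigma] obeys the same halving rule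
([sigma_half]). *)

(** * Determinant identities over a commutative ring *)
Section Determinants.
Variable R : comNzRingType.

(** Schur complement without an inverse: a matrix [X] solving [X *m D = B] is
enough to clear the block [B], whether or not [D] is invertible. *)
Lemma det_schur_dr p q (A : 'M[R]_p) (B : 'M_(p, q)) (C : 'M_(q, p))
    (D : 'M_q) (X : 'M_(p, q)) :
  X *m D = B -> \det (block_mx A B C D) = \det (A - X *m C) * \det D.
Proof.
move=> <-.
have -> : block_mx A (X *m D) C D =
          block_mx 1%:M X 0 1%:M *m block_mx (A - X *m C) 0 C D.
  by rewrite mulmx_block !mul1mx !mul0mx !add0r subrK.
by rewrite det_mulmx det_ublock !det1 !mul1r det_lblock.
Qed.

Lemma det_schur_ul p q (A : 'M[R]_p) (B : 'M_(p, q)) (C : 'M_(q, p))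
    (D : 'M_q) (Y : 'M_(q, p)) :
  Y *m A = C -> \det (block_mx A B C D) = \det A * \det (D - Y *m B).
Proof.
move=> <-.
have -> : block_mx A B (Y *m A) D =
          block_mx 1%:M 0 Y 1%:M *m block_mx A B 0 (D - Y *m B).
  by rewrite mulmx_block !mul1mx !mul0mx !addr0 addrC subrK.
by rewrite det_mulmx det_lblock !det1 !mul1r det_ublock.
Qed.

Lemma det_block_sym n (P Q : 'M[R]_n) :
  \det (block_mx P Q Q P) = \det (P + Q) * \det (P - Q).
Proof.
have <- : \det (block_mx 1%:M 0 1%:M 1%:M *m block_mx P Q Q P
                *m block_mx 1%:M 0 (- 1%:M) 1%:M) = \det (block_mx P Q Q P).
  by rewrite !det_mulmx !det_lblock !det1 !mul1r !mulr1.
rewrite !mulmx_block !(mul1mx, mul0mx, mulmx0, mulmx1, mulmxN, addr0, add0r).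
by rewrite [Q + P]addrC subrr det_ublock mulrC.
Qed.

(** The product of three transvections that rotates the two block columns has
determinant 1, and makes the matrix block triangular. *)
Lemma det_block_anti n (P Z : 'M[R]_n) :
  \det (block_mx 0 P P Z) = (-1) ^+ n * \det P ^+ 2.
Proof.
have <- : \det (block_mx 0 P P Z *m (block_mx 1%:M (- 1%:M) 0 1%:M
      *m block_mx 1%:M 0 1%:M 1%:M *m block_mx 1%:M (- 1%:M) 0 1%:M))
    = \det (block_mx 0 P P Z).
  by rewrite !det_mulmx !det_lblock !det_ublock !det1 !mulr1.
rewrite !mulmx_block !(mul1mx, mul0mx, mulmx0, mulmx1, mulmxN, addr0, add0r,
  subrr, oppr0, addNr).
by rewrite det_lblock -scaleN1r detZ expr2 mulrCA.
Qed.

(** The source of [f] is an ordinal type whose bound is a sum in the uses below,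
for block decompositions; this bound is only propositionally equal to [n]. *)
Lemma det_reindex m n (f : 'I_m -> nat) (F : nat -> nat -> R) :
    m = n -> injective f -> (forall i, f i < n)%N ->
  \det (\matrix_(i < n, j < n) F i j) = \det (\matrix_(i, j) F (f i) (f j)).
Proof.
move=> mn; case: n / mn => f_inj f_lt.
have g_inj : injective (fun i => Ordinal (f_lt i)).
  by move=> i j /(congr1 val) /f_inj.
set A := (X in \det X = _).
have -> : \matrix_(i, j) F (f i) (f j)
          = row_perm (perm g_inj) (col_perm (perm g_inj) A).
  by apply/matrixP=> i j; rewrite !mxE !permE.
rewrite row_permE col_permE !det_mulmx !det_perm mulrCA.
by rewrite odd_permV -signr_addb addbb mulr1.
Qed.

Lemma det_parity n (F : nat -> nat -> R) :
  \det (\matrix_(i < n, j < n) F i j) =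
  \det (block_mx
    (\matrix_(i < uphalf n, j < uphalf n) F i.*2 j.*2)
    (\matrix_(i < uphalf n, j < n./2) F i.*2 j.*2.+1)
    (\matrix_(i < n./2, j < uphalf n) F i.*2.+1 j.*2)
    (\matrix_(i < n./2, j < n./2) F i.*2.+1 j.*2.+1)).
Proof.
pose f (i : 'I_(uphalf n + n./2)) : nat :=
  match split i with inl j => j.*2 | inr j => j.*2.+1 end.
rewrite (@det_reindex (uphalf n + n./2) n f); first 1 last.
- by rewrite uphalf_half -addnA addnn odd_double_half.
- move=> i j; rewrite /f; move: (splitK i) (splitK j).
  case: split => a <-; case: split => b <- /= eqf; try lia;
  by congr (_ _ _); apply: val_inj => /=; lia.
- by move=> i; rewrite /f; case: split => j; have := ltn_ord j; lia.
congr (\det _); apply/matrixP=> i j; rewrite !mxE /f.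
by case: splitP => a _; rewrite !mxE; case: splitP => b _; rewrite mxE.
Qed.

(** The entries of [L *m F *m L^T], where [L] subtracts [w i] times row [k i] from
row [i]. *)
Definition eliminate (w : nat -> R) (k : nat -> nat) (F : nat -> nat -> R) i j :=
  F i j - w i * F (k i) j - w j * (F i (k j) - w i * F (k i) (k j)).

(** Row [i] is only corrected by a row above it, so [L] is unitriangular. *)
Lemma det_congr n (F : nat -> nat -> R) (w : nat -> R) (k : nat -> nat) :
    (forall i, w i != 0 -> (k i < i)%N) ->
  \det (\matrix_(i < n, j < n) F i j) =
  \det (\matrix_(i < n, j < n) eliminate w k F i j).
Proof.
move=> wk.
pose L : 'M[R]_n := \matrix_(i, j) ((i == j)%:R - w i * (k i == j :> nat)%:R).
have detL : \det L = 1.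
  rewrite det_trig; last first.
    apply/is_trig_mxP => i j ij; rewrite mxE.
    have [->|/wk ki] := eqVneq (w i) 0; first by rewrite mul0r subr0 -val_eqE ltn_eqF.
    by rewrite -val_eqE ltn_eqF // ltn_eqF ?mulr0 ?subr0 // (ltn_trans ki).
  rewrite big1 // => i _; rewrite mxE eqxx.
  have [->|/wk ki] := eqVneq (w i) 0; first by rewrite mul0r subr0.
  by rewrite ltn_eqF // mulr0 subr0.
have LE p (A : 'M[R]_(n, p)) (G : nat -> 'I_p -> R) i j :
    (forall a b, A a b = G a b) -> (L *m A) i j = G i j - w i * G (k i) j.
  move=> AG; rewrite mxE.
  under eq_bigr => a _ do rewrite mxE AG mulrBl -mulrA.
  rewrite sumrB -mulr_sumr (bigD1 i) //= eqxx mul1r big1 ?addr0; last first.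
    by move=> a ai; rewrite eq_sym (negbTE ai) mul0r.
  congr (_ - _).
  have [->|/wk ki] := eqVneq (w i) 0; first by rewrite !mul0r.
  have kn := ltn_trans ki (ltn_ord i).
  rewrite (bigD1 (Ordinal kn)) //= eqxx mul1r big1 ?addr0 // => a.
  by rewrite -val_eqE /= eq_sym => /negbTE ->; rewrite mul0r.
rewrite -[LHS]mul1r -[LHS]mulr1 -{1}detL -{1}detL -{2}det_tr -!det_mulmx.
congr (\det _); apply/matrixP => i j; rewrite [RHS]mxE.
rewrite -[L *m _ *m _]trmxK trmx_mul trmxK mxE.
rewrite (LE _ _ (fun a b => F b a - w b * F (k b) a)) //.
move=> a b; rewrite mxE (LE _ _ (fun a b => F a b)) // => c e; by rewrite mxE.
Qed.

End Determinants.

(** * Constant perturbations *)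
Section RankOne.
Variable F : fieldType.

Lemma const_mx1E p q :
  const_mx 1 = (const_mx 1 : 'cV_p) *m (const_mx 1 : 'rV_q) :> 'M[F]_(p, q).
Proof. by apply/matrixP => i j; rewrite !mxE big_ord1 !mxE mulr1. Qed.

(** The sum of the entries of the inverse of [D]: by the matrix determinant lemma
it governs every perturbation of [D] by constant matrices. *)
Definition inv_sum n (D : 'M[F]_n) : F :=
  ((const_mx 1 : 'rV_n) *m invmx D *m (const_mx 1 : 'cV_n)) 0 0.

Lemma const_mx1_inv p q r (D : 'M[F]_q) :
  (const_mx 1 : 'M_(p, q)) *m invmx D *m (const_mx 1 : 'M_(q, r))
  = const_mx (inv_sum D).
Proof.
rewrite (const_mx1E p q) (const_mx1E q r) mulmxA -(mulmxA (const_mx 1 : 'cV_p)).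
rewrite -(mulmxA (const_mx 1 : 'cV_p)) [_ *m invmx D *m _]mx11_scalar -/(inv_sum D).
by apply/matrixP => i j; rewrite mul_mx_scalar -scalemxAl -const_mx1E !mxE mulr1.
Qed.

(** The bordered matrix [[-1/z, 1], [1, D]] is evaluated with the Schur complement
of either diagonal block. *)
Lemma det_add_const n (D : 'M[F]_n) (z : F) :
    D \in unitmx -> z != 0 ->
  \det (D + const_mx z) = \det D * (1 + z * inv_sum D).
Proof.
move=> uD z0.
pose A : 'M[F]_1 := const_mx (- z^-1).
pose B : 'M[F]_(1, n) := const_mx 1; pose C : 'M[F]_(n, 1) := const_mx 1.
have Zs : - z^-1 != 0 by rewrite oppr_eq0 invr_eq0.
apply: (mulfI Zs).
transitivity (\det (block_mx A B C D)).
  rewrite (@det_schur_ul _ _ _ _ _ _ _ (const_mx (- z))).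
    rewrite det_mx11 mxE; congr (_ * _); congr (\det _).
    by apply/matrixP => i j; rewrite !mxE big_ord1 !mxE mulr1 opprK.
  by apply/matrixP => i j; rewrite !mxE big_ord1 !mxE mulrNN mulfV.
rewrite (@det_schur_dr _ _ _ _ _ _ _ (B *m invmx D)) ?mulmxKV //.
rewrite const_mx1_inv det_mx11 !mxE mulrCA mulrC; congr (_ * _).
by rewrite mulrDr mulr1 mulNr mulKf.
Qed.

Lemma det_block_const p q (A : 'M[F]_p) (D : 'M[F]_q) : D \in unitmx ->
  \det (block_mx A (const_mx 1) (const_mx 1) D)
  = \det D * \det (A + const_mx (- inv_sum D)).
Proof.
move=> uD; rewrite (@det_schur_dr _ _ _ _ _ _ _ (const_mx 1 *m invmx D)) ?mulmxKV //.
rewrite const_mx1_inv mulrC; congr (_ * _); congr (\det _).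
by apply/matrixP => i j; rewrite !mxE.
Qed.

End RankOne.

(** * Digit sums and their differences *)
Lemma digit_sum_widen m n : (m <= n)%N ->
  digit_sum m = (\sum_(i < n) odd (m %/ 2 ^ i))%N.
Proof.
move=> mn; rewrite /digit_sum -!(big_mkord xpredT (fun i => odd (m %/ 2 ^ i) : nat)).
rewrite [RHS](big_cat_nat (n := m)) //= [X in (_ + X)%N]big_nat_cond.
rewrite [X in (_ + X)%N]big1 ?addn0 // => i /andP[/andP[mi _] _].
by rewrite divn_small // (leq_ltn_trans mi) // ltn_expl.
Qed.

Lemma digit_sum_half m : digit_sum m = (odd m + digit_sum m./2)%N.
Proof.
rewrite (@digit_sum_widen m m.+1) // big_ord_recl divn1; congr (_ + _)%N.
rewrite (@digit_sum_widen m./2 m); last by lia.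
by apply: eq_bigr => i _; rewrite /= /bump add1n expnS divnMA divn2.
Qed.

Definition digits (m : nat) : rat := (digit_sum m)%:R.
Definition diff1 (m : nat) : rat := digits m.+1 - digits m.
Definition diff2 (m : nat) : rat := diff1 m.+1 - diff1 m.

Lemma digits_even m : digits m.*2 = digits m.
Proof. by rewrite /digits digit_sum_half odd_double doubleK. Qed.

Lemma digits_odd m : digits m.*2.+1 = digits m + 1.
Proof. by rewrite /digits digit_sum_half /= odd_double uphalf_double natrD addrC. Qed.

Lemma diff1_even m : diff1 m.*2 = 1.
Proof. by rewrite /diff1 digits_odd digits_even; ring. Qed.

Lemma diff1_odd m : diff1 m.*2.+1 = diff1 m - 1.
Proof. by rewrite /diff1 -doubleS digits_odd digits_even; ring. Qed.

Lemma diff2_even m : diff2 m.*2 = diff1 m - 2.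
Proof. by rewrite /diff2 diff1_odd diff1_even; ring. Qed.

Lemma diff2_odd m : diff2 m.*2.+1 = 2 - diff1 m.
Proof. by rewrite /diff2 -doubleS diff1_odd diff1_even; ring. Qed.

(** The shift [x] of all the entries is what makes the recursion close: halving
the index of a Hankel determinant of digit sums changes its entries by
constants. *)
Definition pencil (u : nat -> rat) (n : nat) (x : rat) : rat :=
  \det (\matrix_(i < n, j < n) (u (i + j)%N + x)).

(** * Halving the Hankel pencils *)

(** Terms of even index are constant, so the parity blocks form the pattern
[[P, Q], [Q, P]] with [P] constant. *)
Lemma pencil_diff1_even m x :
  pencil diff1 m.*2 x = (-1) ^+ m * pencil diff1 m (2 * x) * pencil diff1 m (- 2).
Proof.
rewrite /pencil (det_parity _ (fun i j => diff1 (i + j)%N + x)).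
rewrite uphalf_double doubleK.
transitivity (\det (block_mx (const_mx (1 + x))
    (\matrix_(i < m, j < m) (diff1 (i + j)%N - 1 + x))
    (\matrix_(i < m, j < m) (diff1 (i + j)%N - 1 + x)) (const_mx (1 + x)))).
  by congr (\det (block_mx _ _ _ _)); apply/matrixP => i j;
    rewrite !mxE ?addSn ?addnS -?doubleD -?doubleS ?diff1_even ?diff1_odd.
rewrite det_block_sym -mulrA mulrCA -detZ; congr (_ * _); congr (\det _);
  by apply/matrixP => i j; rewrite !mxE; ring.
Qed.

(** Terms of index [2k] and [2k+1] are opposite, so adding to each odd row and
column the preceding even one makes the matrix block diagonal. *)
Lemma pencil_diff2 n :
  pencil diff2 n 0 = pencil diff1 (uphalf n) (- 2) * pencil diff2 n./2 0.
Proof.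
rewrite /pencil.
rewrite (@det_congr _ _ (fun i j => diff2 (i + j)%N + 0)
  (fun i => - (odd i)%:R) predn); last by case=> [|i] //=; rewrite ?oppr0 ?eqxx.
rewrite (det_parity _ (eliminate _ _ _)).
rewrite -(det_lblock _ 0).
by congr (\det (block_mx _ _ _ _)); apply/matrixP => i j;
  rewrite !mxE /eliminate /= ?odd_double /= ?addSn ?addnS -?doubleD -?doubleS
    ?diff2_even ?diff2_odd /diff2; ring.
Qed.

(** Subtracting from the rows and columns of even index [i >= 2] those of index
[i - 2] leaves [1 + x] as the only nonzero entry in the even-even block, at
[(0, 0)].  The rows of even index [i >= 2] then hold only the Hankel matrix [D]
of the second differences, against the odd columns; when [D] is invertible these
rows also clear the remaining entries of row [0]. *)
Lemma pencil_diff1_odd m x : pencil diff2 m 0 != 0 ->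
  pencil diff1 m.*2.+1 x = (-1) ^+ m * pencil diff2 m 0 ^+ 2 * (1 + x).
Proof.
move=> Gm; rewrite /pencil.
rewrite (@det_congr _ _ (fun i j => diff1 (i + j)%N + x)
  (fun i => ((0 < i) && ~~ odd i)%N%:R) (fun i => i.-2)); last first.
  by case=> [|[|i]] //=; rewrite ?eqxx.
(* The order of the indices is 0, then 2, 4, .., 2m, then 1, 3, .., 2m - 1. *)
pose f (i : 'I_(1 + (m + m))) : nat := match split i with
  | inl _ => 0 | inr i' =>
  match split i' with inl a => a.*2.+2 | inr a => a.*2.+1 end end.
rewrite (@det_reindex _ _ _ f (eliminate _ _ _)); first 1 last.
- by lia.
- move=> i j; rewrite /f; move: (splitK i) (splitK j).
  case: split => a <-; case: split => b <- /=.
  + by rewrite !ord1.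
  + by case: split.
  + by case: split.
  move: (splitK a) (splitK b).
  case: split => c <-; case: split => e <- /= eqf; try lia;
  by do 2 congr (_ _ _); apply: val_inj => /=; lia.
- by move=> i; rewrite /f; case: split => // a; case: split => b;
    have := ltn_ord b; lia.
have f0 a : f (lshift _ a) = 0%N by rewrite /f (unsplitK (inl _)).
have f1 a : f (rshift _ (lshift _ a)) = a.*2.+2.
  by rewrite /f (unsplitK (inr _)) (unsplitK (inl _)).
have f2 a : f (rshift _ (rshift _ a)) = a.*2.+1.
  by rewrite /f !(unsplitK (inr _)).
pose D := \matrix_(i < m, j < m) (diff2 (i + j)%N + 0).
pose r := \row_(j < m) (diff1 j - 1 + x).
transitivity (\det (block_mx (1 + x)%:M (row_mx 0 r) (row_mx 0 r)^T
   (block_mx 0 D D (const_mx (1 + x))))).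
  congr (\det _); apply/matrixP => i j; rewrite mxE /eliminate.
  case: (split_ordP i) => a ->; case: (split_ordP j) => b ->.
  - by rewrite block_mxEul !f0 mxE !ord1 /= (diff1_even 0); ring.
  - rewrite block_mxEur f0; case: (split_ordP b) => c ->.
    + by rewrite row_mxEl mxE f1 /= odd_double /= -doubleS !diff1_even; ring.
    + by rewrite row_mxEr mxE f2 /= odd_double /= diff1_odd; ring.
  - rewrite block_mxEdl mxE f0; case: (split_ordP a) => c ->.
    + by rewrite row_mxEl mxE f1 /= odd_double /= !addn0 -doubleS !diff1_even; ring.
    + by rewrite row_mxEr mxE f2 /= odd_double /= !addn0 diff1_odd; ring.
  - rewrite block_mxEdr.
    case: (split_ordP a) => c ->; case: (split_ordP b) => e ->;
      rewrite (block_mxEul, block_mxEur, block_mxEdl, block_mxEdr) mxE ?f1 ?f2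
        /= !odd_double /= ?addSn ?addnS -?doubleD -?doubleS ?diff1_even ?diff1_odd
        /diff2;
      ring.
have uD : D \in unitmx by rewrite unitmxE unitfE.
rewrite (@det_schur_dr _ _ _ _ _ _ _ (row_mx (r *m invmx D) 0)); last first.
  by rewrite mul_row_block mulmx0 !mul0mx !addr0 mulmxKV.
rewrite tr_row_mx mul_row_col trmx0 mulmx0 mul0mx addr0 subr0.
by rewrite det_mx11 mxE mulr1n det_block_anti mulrC.
Qed.

(** Subtracting from each odd row and column the preceding even one turns the
even-odd blocks into the constant 1, and the odd-odd block into the Hankel matrix
of [diff1 - 2]. *)
Lemma pencil_digits_step n : pencil diff1 n./2 (- 2) != 0 ->
  exists2 c, pencil diff1 n./2 0 = pencil diff1 n./2 (- 2) * (1 + 2 * c)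
  & forall x, pencil digits n x =
              pencil diff1 n./2 (- 2) * pencil digits (uphalf n) (x - c).
Proof.
move=> nz; set q := n./2 in nz *; set p := uphalf n.
pose D := \matrix_(i < q, j < q) (diff1 (i + j)%N + - 2).
have uD : D \in unitmx by rewrite unitmxE unitfE.
exists (inv_sum D).
  rewrite -[X in X * _]/(\det D) -det_add_const //.
  by congr (\det _); apply/matrixP => i j; rewrite !mxE; ring.
move=> x; rewrite /pencil.
rewrite (@det_congr _ _ (fun i j => digits (i + j)%N + x)
  (fun i => (odd i)%:R) predn); last by case=> [|i] //=; rewrite ?eqxx.
rewrite (det_parity _ (eliminate _ _ _)) -/p -/q.
transitivity (\det (block_mx (\matrix_(i < p, j < p) (digits (i + j)%N + x))
                  (const_mx 1) (const_mx 1) D)).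
  by congr (\det (block_mx _ _ _ _)); apply/matrixP => i j;
    rewrite !mxE /eliminate /= ?odd_double /= ?addSn ?addnS -?doubleD -?doubleS
    ?digits_even ?digits_odd /diff1; ring.
rewrite det_block_const //; congr (_ * _); congr (\det _).
by apply/matrixP => i j; rewrite !mxE addrA.
Qed.

(** * Signs *)

(** The root of the pencil is [- 1 / t]; [t] is the largest power of 2 dividing
[n], of which only [1 <= t] matters.  Nonvanishing of the pencil of [diff2] has to
be carried along, because the odd case rests on it. *)
Lemma pencil_diff1_affine n : pencil diff2 n 0 != 0 /\
  ((0 < n)%N -> exists c t, [/\ 1 <= t, 0 < (-1) ^+ (uphalf n).+1 * c
                      & forall x, pencil diff1 n x = c * (1 + t * x)]).
Proof.
elim/ltn_ind: n => n IH.
have affine : (0 < n)%N -> exists c t, [/\ 1 <= t,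
    0 < (-1) ^+ (uphalf n).+1 * c & forall x, pencil diff1 n x = c * (1 + t * x)].
  move=> n0; pose m := n./2.
  have sgn2 : (-1) ^+ m * (-1) ^+ m = 1 :> rat by rewrite -expr2 sqrr_sign.
  have [n_odd|n_even] := boolP (odd n).
    have nE : n = m.*2.+1 by rewrite /m; lia.
    have [|Gm _] := IH m; first by rewrite /m; lia.
    exists ((-1) ^+ m * pencil diff2 m 0 ^+ 2), 1; split=> // [|x].
      rewrite nE /= doubleK 2!exprS mulN1r mulN1r opprK mulrA sgn2 mul1r.
      by rewrite exprn_even_gt0.
    by rewrite {1}nE pencil_diff1_odd // mul1r.
  have nE : n = m.*2 by rewrite /m; lia.
  have m_lt : (m < n)%N by lia.
  have m_gt0 : (0 < m)%N by lia.
  have [c [t [t1 c0 cE]]] := (IH m m_lt).2 m_gt0.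
  exists ((-1) ^+ m * c * (c * (1 + t * - 2))), (2 * t).
  split=> [||x]; first by lra.
    rewrite nE uphalf_double exprS.
    have -> : -1 * (-1) ^+ m * ((-1) ^+ m * c * (c * (1 + t * -2))) =
              (-1) ^+ m * (-1) ^+ m * (c ^+ 2 * (2 * t - 1)) by ring.
    rewrite sgn2 mul1r mulr_gt0 //; last by lra.
    by rewrite exprn_even_gt0 //=; apply: contraTneq c0 => ->; rewrite mulr0 ltxx.
  by rewrite {1}nE pencil_diff1_even !cE; ring.
split=> //.
have [->|n0] := posnP n; first by rewrite /pencil det_mx00 oner_eq0.
rewrite pencil_diff2 mulf_neq0 //; last by have [|] := IH n./2; first lia.
(* Here [uphalf n < n] fails for [n = 1], where the case just proved applies. *)
have [c [t [t1 c0 ->]]] : exists c t, [/\ 1 <= t,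
    0 < (-1) ^+ (uphalf (uphalf n)).+1 * c
  & forall x, pencil diff1 (uphalf n) x = c * (1 + t * x)].
  have [pn|pn] := ltnP (uphalf n) n; first by apply: (IH _ pn).2; lia.
  have -> : uphalf n = n by lia.
  exact: affine.
rewrite mulf_neq0 //; last by lra.
by apply: contraTneq c0 => ->; rewrite mulr0 ltxx.
Qed.

(** In terms of [t] from [pencil_diff1_affine], the relation of
[pencil_digits_step] reads [(1 - 2 t) (1 + 2 c) = 1], so that the shift [- c] is
[t / (2 t - 1)]: its positivity is what keeps the determinants from vanishing. *)
Lemma pencil_digits_half n : (2 <= n)%N -> exists f e, [/\ 0 < e,
    0 < (-1) ^+ (uphalf n./2) * f
  & forall x, pencil digits n x = f * pencil digits (uphalf n) (x + e)].
Proof.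
move=> n2.
have [_ [|c [t [t1 c0 cE]]]] := pencil_diff1_affine n./2; first by lia.
have c_neq0 : c != 0 by apply: contraTneq c0 => ->; rewrite mulr0 ltxx.
have f_neq0 : pencil diff1 n./2 (- 2) != 0 by rewrite cE mulf_neq0 //; lra.
have [c' + stepE] := pencil_digits_step f_neq0.
rewrite !cE mulr0 addr0 -mulrA => /(mulfI c_neq0) c'E.
exists (pencil diff1 n./2 (- 2)), (- c'); split=> //.
- nra.
- rewrite cE mulrA mulrC; move: c0; rewrite exprS mulN1r mulNr oppr_gt0 => c0.
  by rewrite nmulr_rgt0 //; lra.
Qed.

(** For [n > 8], halving keeps [n] in the same half of its dyadic block, and it
commutes with both reductions [n |-> n - 2^k] and [n |-> 2^(k+1) - n + 1], so the
rule passes from the reduced index to [n].  The values [n <= 8] are computed; they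
include those for which the exceptional [sigma 4] intervenes. *)
Lemma sigma_half n : (3 <= n)%N ->
  sigma n = (-1) ^+ uphalf n./2 * sigma (uphalf n).
Proof.
elim/ltn_ind: n => n IH n3.
have [n8|n8] := leqP n 8.
  by case: n n3 n8 {IH} => [|[|[|[|[|[|[|[|[|n]]]]]]]]] // _ _; vm_compute.
have n0 : (0 < n.-1)%N by lia.
have /= := trunc_log_bounds (isT : 1 < 2)%N n0.
case: (trunc_log 2 n.-1) => [|[|[|k]]]; [lia..|].
move=> hk; have k0 : (0 < 2 ^ k)%N by rewrite expn_gt0.
rewrite (@sigmaE n k.+3); [|lia..].
rewrite (@sigmaE (uphalf n) k.+2); [|move: hk; rewrite ?expnS; lia..].
move: hk k0; rewrite /= !expnS; move: (2 ^ k)%N => e hk k0.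
have -> : (uphalf n <= 3 * (2 * e))%N = (n <= 3 * (2 * (2 * e)))%N by lia.
case: ifP => ncase; (rewrite IH; [|lia..]); last first.
  congr (_ * sigma _); last by lia.
  by rewrite -signr_odd -[RHS]signr_odd; congr (_ ^+ nat_of_bool _); lia.
rewrite !mulrA -!exprD; congr (_ * sigma _); last by lia.
by rewrite -signr_odd -[RHS]signr_odd; congr (_ ^+ nat_of_bool _); lia.
Qed.

(** The root [- r] is [0] at [n = 1] and moves left with every doubling, so the
induction starts at [n = 2]. *)
Lemma pencil_digits_affine n : (2 <= n)%N -> exists b r, [/\ 0 < r,
    0 < (sigma n)%:~R * b & forall x, pencil digits n x = b * (x + r)].
Proof.
elim/ltn_ind: n => n IH n2.
have [f [e [e0 f0 fE]]] := pencil_digits_half n2.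
have [n3|n3] := leqP 3 n.
  have [||b [r [r0 b0 bE]]] := IH (uphalf n); [lia..|].
  exists (f * b), (e + r); split=> [||x]; first by lra.
    by rewrite sigma_half // rmorphM rmorphXn /= rmorphN1 mulrACA mulr_gt0.
  by rewrite fE bE; ring.
have nE : n = 2 by lia.
move: f0 fE; rewrite nE /= => f0 fE.
exists f, e; split=> // x.
by rewrite fE /pencil det_mx11 mxE /digits /digit_sum big_ord0 add0r.
Qed.

Lemma sigma_sign n : sigma n \in [:: 1; -1].
Proof.
rewrite /sigma; elim: {1}n {-1}n => [|f IH] m //=.
case: ifP => // _; case: ifP => // _; case: ifP => // _.
have := IH (2 ^ (trunc_log 2 m.-1).+1 - m + 1)%N.
by rewrite -signr_odd !inE; case: (odd m) => /orP[]/eqP->.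
Qed.

Theorem corollary4p11 (n : nat) (hn : (2 <= n)%N) :
  hankel n != 0 /\ sgz (hankel n) = sigma n.
Proof.
have [b [r [r0 b0 bE]]] := pencil_digits_affine hn.
have hE : (hankel n)%:~R = b * r.
  rewrite -[r]add0r -bE /pencil /hankel -[LHS]det_map_mx; congr (\det _).
  by apply/matrixP => i j; rewrite !mxE addr0.
have : 0 < sigma n * hankel n by rewrite -(ltr0z rat) rmorphM /= hE mulrA mulr_gt0.
have := sigma_sign n.
rewrite !inE => /orP[]/eqP->; rewrite ?mul1r ?mulN1r ?oppr_gt0 => h.
  by rewrite gtr0_sgz ?gt_eqF.
by rewrite ltr0_sgz ?lt_eqF.
Qed.
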